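(* Let $H$ be the Hamiltonian with the preferred-orientation coupling at every vertex of the equilateral metric graph formed by the vertices and edges of the regular tetrahedron, all edges having length $1$. Then the square roots $k$ of the eigenvalues $k^2$ of $H$ are, for large $k$, contained in the intervals $$\left(n\pi-\frac{2\sqrt3}{k}+\mathcal O\!\left(\frac1{k^2}\right),\; n\pi+\frac{2\sqrt3}{k}+\mathcal O\!\left(\frac1{k^2}\right)\right),\qquad n\in\mathbb Z .$$ That is, there exist constants $C,K>0$ such that for every $k\ge K$ for which $k^2$ is an eigenvalue of $H$ there is $n\in\mathbb Z$ with $$|k-n\pi|<\frac{2\sqrt3}{k}+\frac{C}{k^2}.$$
   Context: Graph: the metric graph whose vertices and edges are those of the given Platonic solid in $\mathbb R^3$; each of its $N$ edges is identified with the interval $(0,1)$ (the choice of direction of the identification is immaterial). Operator: $H$ acts on $\bigoplus_{e=1}^N L^2((0,1))$ as $f_e\mapsto -f_e''$ on every edge. Its domain consists of all functions in $\bigoplus_{e=1}^N W^{2,2}((0,1))$ satisfying, at every vertex $v$, the coupling condition $$(U_v-I)\Psi_v+i(U_v+I)\Psi_v'=0,$$ where $\Psi_v\in\mathbb C^d$ is the vector of boundary values at $v$ of the functions on the $d$ edges meeting at $v$ ($d$ is the degree of $v$), and $\Psi_v'\in\mathbb C^d$ is the vector of the corresponding outgoing derivatives, i.e. $f'(0)$ if $v$ corresponds to the endpoint $x=0$ of the edge, and $-f'(1)$ if $v$ corresponds to the endpoint $x=1$. Preferred-orientation coupling: at every vertex the edges are numbered $1,\dots,d$ consecutively in the clockwise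 cyclic order as seen from the exterior of the solid, and $U_v$ is the $d\times d$ cyclic permutation matrix with $(U_v)_{m,m+1}=1$ for $m=1,\dots,d-1$, $(U_v)_{d,1}=1$, and all other entries $0$. Explicitly, with cyclic indices, the coupling condition reads $\psi_{m+1}-\psi_m+i(\psi'_{m+1}+\psi'_m)=0$ for $m=1,\dots,d$. The operator $H$ is self-adjoint with purely discrete spectrum. Only positive eigenvalues $k^2$ with $k>0$ are considered. *)

(* Defs.v *)
From HB Require Import structures.
From mathcomp Require Import all_boot all_order all_algebra.
From mathcomp Require Import complex.
From mathcomp Require Import all_classical all_reals all_analysis.

Set Implicit Arguments.
Unset Strict Implicit.
Unset Printing Implicit Defensive.

Import Order.TTheory GRing.Theory Num.Theory.
Import numFieldNormedType.Exports.

Local Open Scope classical_set_scope.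
Local Open Scope ring_scope.
Local Open Scope complex_scope.

Section Sobolev.
Context {R : realType}.
Implicit Types f g : R -> R[i].

Local Notation mu := (@lebesgue_measure R).

Definition unit_itv : set R := `]0, 1[.

(* L^2((0,1)).  Functions on (0,1) are represented by functions on R whose
   values outside (0,1) are irrelevant. *)
Definition L2 f : Prop :=
  (patch (fun=> 0) unit_itv (fun x => complex.Re (f x)) \in Lfun mu 2%:E) /\
  (patch (fun=> 0) unit_itv (fun x => complex.Im (f x)) \in Lfun mu 2%:E).

(* C^1_c((0,1)), extended by zero to R.  Weak derivatives in L^2 tested against
   C^1_c agree with those tested against C^oo_c, by mollification (Brezis,
   Functional Analysis, Sobolev Spaces and PDE, Section 8.2). *)
Definition test_function (phi : R -> R) : Prop :=
  [/\ forall x, derivable phi x 1, continuous (derive1 phi) &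
      exists a b : R, [/\ 0 < a, b < 1 &
        forall x, x \notin `[a, b] -> phi x = 0]].

Definition weak_derivative f g : Prop :=
  forall phi, test_function phi ->
    (\int[mu]_(x in unit_itv) (complex.Re (f x) * derive1 phi x) =
       - \int[mu]_(x in unit_itv) (complex.Re (g x) * phi x)) /\
    (\int[mu]_(x in unit_itv) (complex.Im (f x) * derive1 phi x) =
       - \int[mu]_(x in unit_itv) (complex.Im (g x) * phi x)).

(* f \in W^{1,2}((0,1)) with f' = g *)
Definition W12 f g : Prop := [/\ L2 f, L2 g & weak_derivative f g].

(* f \in W^{2,2}((0,1)) with f' = f1 and f'' = f2 *)
Definition W22 f f1 f2 : Prop := W12 f f1 /\ W12 f1 f2.

(* The value at x = 0 (b = false) or x = 1 (b = true) of the representative of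
   f that is continuous on [0,1]. *)
Definition boundary_value f (b : bool) (z : R[i]) : Prop :=
  exists g : R -> R[i],
    [/\ {within `[0, 1], continuous (fun x => complex.Re (g x))},
        {within `[0, 1], continuous (fun x => complex.Im (g x))},
        {ae mu, forall x, unit_itv x -> f x = g x} & g b%:R = z].

End Sobolev.

(* An equilateral metric graph with edge set E is given by the map
   vert : E * bool -> V sending (e, false) to the vertex at the endpoint x = 0
   of e and (e, true) to the vertex at the endpoint x = 1.  The pairs (e, b)
   are the edge ends; in a d-regular graph, num v m is the m-th edge end at
   the vertex v. *)
Section Hamiltonian.
Context {R : realType} {V E : finType} {d : nat}.
Implicit Types (vert : E * bool -> V) (num : V -> 'I_d -> E * bool).
Implicit Types f h : E -> R -> R[i].

Local Notation mu := (@lebesgue_measure R).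

Definition numbering vert num : Prop :=
  forall v, injective (num v) /\
    forall t, vert t = v <-> exists m, num v m = t.

(* the vertex coupling matrix; ordS is the cyclic successor *)
Definition cyclic_mx : 'M[R[i]]_d := \matrix_(m, l) (l == ordS m)%:R.

Definition coupling (psi psi' : 'cV[R[i]]_d) : Prop :=
  (cyclic_mx - 1%:M) *m psi + 'i *: ((cyclic_mx + 1%:M) *m psi') = 0.

(* f belongs to the domain of H and H f = h; val (e, b) and der (e, b) are the
   boundary value and the outgoing derivative of f at the edge end (e, b). *)
Definition hamiltonian num f h : Prop :=
  exists (f1 : E -> R -> R[i]) (val der : E * bool -> R[i]),
    [/\ forall e, W22 (f e) (f1 e) (fun x => - h e x),
        forall e b, boundary_value (f e) b (val (e, b)),
        forall e b, boundary_value (f1 e) b ((-1) ^+ b * der (e, b)) &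
        forall v, coupling (\col_m val (num v m)) (\col_m der (num v m))].

Definition hamiltonian_eigenvalue num (lambda : R[i]) : Prop :=
  exists f, hamiltonian num f (fun e x => lambda * f e x) /\
    ~ (forall e, {ae mu, forall x, unit_itv x -> f e x = 0}).

End Hamiltonian.

Section Tetrahedron.
Context {R : realType}.
Implicit Types P : 'I_4 -> 'rV[R]_3.

(* The four vertices of a regular tetrahedron with edge length 1. *)
Definition regular_tetrahedron P : Prop :=
  forall v w, v != w -> \sum_j (P v 0 j - P w 0 j) ^+ 2 = 1.

(* Any two vertices are joined by exactly one edge. *)
Definition tetra_edge : finType := {e : {set 'I_4} | #|e| == 2}.

(* vert chooses the direction in which each edge is identified with (0,1). *)
Definition edge_ends (vert : tetra_edge * bool -> 'I_4) : Prop :=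
  forall e, sval e = [set vert (e, false); vert (e, true)]%SET.

Definition centroid P : 'rV[R]_3 := 4%:R^-1 *: \sum_v P v.

(* With n pointing from the centroid to the vertex v (the outward direction),
   the turn from a to b is counterclockwise for an observer outside looking at
   v iff det (n, a, b) > 0, and clockwise iff det (n, a, b) < 0.  As d = 3,
   clockwise turns between cyclically consecutive edges determine the cyclic
   order. *)
Definition clockwise P (vert : tetra_edge * bool -> 'I_4)
    (num : 'I_4 -> 'I_3 -> tetra_edge * bool) : Prop :=
  forall v m,
    let far_end l := let: (e, b) := num v l in P (vert (e, ~~ b)) in
    \det (\matrix_(r < 3) nth 0 [:: P v - centroid P;
                                    far_end m - P v;
                                    far_end (ordS m) - P v] r) < 0.

End Tetrahedron.

(* Main.v *)
(** On every edge the eigenfunctions solve [f'' = - k^2 f], which links the values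
    [x] and outgoing derivatives [y] at opposite edge ends by
    [J x = cos k * x + (sin k / k) * y], with [J] the swap of the two ends of each edge.
    For degree 3 the coupling is equivalent to [y = A x] with
    [(A x)_m = i (x_(m+1) - x_(m-1))] at each vertex, whose norm is [sqrt 3].  Since
    [J] is an isometry, taking norms gives
    [|sin k| (1 - 3 / k^2) <= 2 sqrt 3 / k * |cos k|], and [d <= tan d] on
    [0, pi / 2[ bounds the distance [d] of [k] to the multiples of [pi].

    The edge equation is extracted from its weak form by testing: for continuous [G]
    with vanishing weak derivative, the test function with derivative [chi (G - c)],
    [chi] a bump and [c] the [chi]-average of [G], gives [\int chi (G - c)^2 = 0]. *)
Require Import Defs.
From mathcomp Require Import all_boot all_order all_algebra.
From mathcomp Require Import complex.
From mathcomp Require Import all_classical all_reals all_analysis.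
From mathcomp Require Import measurable_realfun ring lra.

Set Implicit Arguments.
Unset Strict Implicit.
Unset Printing Implicit Defensive.

Import Order.TTheory GRing.Theory Num.Theory.
Import numFieldNormedType.Exports.

Local Open Scope classical_set_scope.
Local Open Scope ring_scope.
Local Open Scope complex_scope.

(** * Integration and continuous functions on the unit interval *)

Section UnitInterval.
Context {R : realType}.
Implicit Types (f g h G F phi psi : R -> R) (a b x : R).
Local Notation mu := (@lebesgue_measure R).

Lemma measurable_unit_itv : measurable (@unit_itv R).
Proof. exact: measurable_itv. Qed.

Lemma integrable_unit_itv h : continuous h ->
  mu.-integrable unit_itv (EFin \o h).
Proof.
move=> ch; have : mu.-integrable `[0, 1] (EFin \o h).
  apply: continuous_compact_integrable; first exact: segment_compact.
  exact: continuous_subspaceT.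
apply: integrableS => //; first exact: measurable_unit_itv.
by move=> x; exact: subset_itv_oo_cc.
Qed.

Lemma Rintegral_unit_itvD f g : continuous f -> continuous g ->
  \int[mu]_(x in unit_itv) (f x + g x) =
  \int[mu]_(x in unit_itv) f x + \int[mu]_(x in unit_itv) g x.
Proof.
move=> cf cg; rewrite RintegralD //;
  [exact: measurable_unit_itv|exact: integrable_unit_itv|exact: integrable_unit_itv].
Qed.

Lemma Rintegral_unit_itvZ a f : continuous f ->
  \int[mu]_(x in unit_itv) (a * f x) = a * \int[mu]_(x in unit_itv) f x.
Proof.
move=> cf; rewrite RintegralZl //;
  [exact: measurable_unit_itv|exact: integrable_unit_itv].
Qed.

Lemma Rintegral_unit_itvB f g : continuous f -> continuous g ->
  \int[mu]_(x in unit_itv) (f x - g x) =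
  \int[mu]_(x in unit_itv) f x - \int[mu]_(x in unit_itv) g x.
Proof.
move=> cf cg; rewrite RintegralB //;
  [exact: measurable_unit_itv|exact: integrable_unit_itv|exact: integrable_unit_itv].
Qed.

Lemma Rintegral_unit_itv_derive F f : continuous f ->
  (forall x, is_derive x 1 F (f x)) -> \int[mu]_(x in unit_itv) f x = F 1 - F 0.
Proof.
move=> cf dF.
have cF : continuous F.
  by move=> x; apply/differentiable_continuous/derivable1_diffP.
have dF01 : derivable_oo_LRcontinuous F 0 1.
  split; first by move=> x _; have [] := dF x.
    by apply: cvg_at_right_filter; exact: cF.
  by apply: cvg_at_left_filter; exact: cF.
have F'f : {in `]0, 1[, F^`()%classic =1 f}.
  by move=> x _; rewrite derive1E; apply: derive_val.
rewrite /Rintegral -(@integral_itv_bndoo _ _ _ _ true false); last first.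
  by case/integrableP: (integrable_unit_itv cf).
by rewrite (continuous_FTC2 ltr01 (continuous_subspaceT cf) dF01 F'f).
Qed.

(** Composing with the clamp [p] onto [[0, 1]] trades continuity within the interval for continuity
    on the line, the form that the integral lemmas take. *)
Lemma continuous_extension_unit_itv g : {within `[0, 1], continuous g} ->
  exists2 h, continuous h & forall x, x \in `[0, 1] -> h x = g x.
Proof.
move=> /subspace_continuousP cg.
pose p := fun x : R => Order.max 0 (Order.min 1 x).
have p01 x : `[0, 1]%classic (p x).
  by rewrite /p /= in_itv /= le_max lexx /= ge_max ler01 ge_min lexx.
have cp : continuous p.
  move=> x; apply: continuous_max; first exact: cvg_cst.
  by apply: continuous_min; [exact: cvg_cst|exact: cvg_id].
exists (g \o p).
  move=> x; apply: cvg_trans (cg _ (p01 x)).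
    have pw : p y @[y --> x] --> within `[0, 1] (nbhs (p x)).
    move=> A wA; have := cp x _ wA; rewrite !nbhs_simpl /=.
    by apply: filterS => y; apply; exact: p01.
  exact: (cvg_comp _ _ pw).
move=> x; rewrite in_itv /= => /andP[x0 x1] /=; congr g.
by rewrite /p min_r // max_r.
Qed.

Lemma zero_on_closed_unit_itv g : {within `[0, 1], continuous g} ->
  (forall x, unit_itv x -> g x = 0) -> forall x, x \in `[0, 1] -> g x = 0.
Proof.
move=> /(continuous_within_itvP _ ltr01)[_ c0 c1] g0 x.
rewrite in_itv /= => /andP[]; rewrite le_eqVlt => /predU1P[<- _|x0].
  apply: (cvg_unique _ c0) => //; apply: cvg_near_cst; near=> y; apply: g0.
  by rewrite /unit_itv /= in_itv /=; apply/andP; split; near: y;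
    [exact: nbhs_right_gt | exact: nbhs_right_lt].
rewrite le_eqVlt => /predU1P[->|x1];
  last by apply: g0; rewrite /unit_itv /= in_itv /= x0.
apply: (cvg_unique _ c1) => //; apply: cvg_near_cst; near=> y; apply: g0.
by rewrite /unit_itv /= in_itv /=; apply/andP; split; near: y;
  [exact: nbhs_left_gt | exact: nbhs_left_lt].
Unshelve. all: by end_near. Qed.

(** A nonzero value would persist on a ball inside the interval, which has positive measure but
    would lie in a null set. *)
Lemma ae_zero_continuous g : continuous g ->
  {ae mu, forall x, unit_itv x -> g x = 0} -> forall x, unit_itv x -> g x = 0.
Proof.
move=> cg [N [mN N0 sub]] x ux; apply: contrapT => /eqP gx.
have : nbhs x [set y | g y != 0 /\ unit_itv y].
  apply: filterI; first apply: (cg x _ (open_nbhs_nbhs (conj (@open_neq _ 0) gx))).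
  by apply: open_nbhs_nbhs; split => //; exact: interval_open.
move=> /nbhs_ballP[e /= e0 be].
have : (mu (ball x e) <= mu N)%E.
  apply: le_measure; rewrite ?inE //; first by rewrite ball_itv; exact: measurable_itv.
  move=> y /be[gy uy]; apply: sub => /= /(_ uy) H.
  by move: gy; rewrite H eqxx.
rewrite N0 lebesgue_measure_ball; last exact: ltW.
by rewrite leNgt lte_fin mulrn_wgt0.
Qed.

Lemma ge0_Rintegral_eq0_continuous h : continuous h -> (forall x, 0 <= h x) ->
  \int[mu]_(x in unit_itv) h x = 0 -> forall x, unit_itv x -> h x = 0.
Proof.
move=> ch h0 ih; apply: ae_zero_continuous => //.
have ih' := integrable_unit_itv ch.
have : ae_eq mu unit_itv (EFin \o h) (cst 0%E).
  apply/ae_eq_integral_abs; first exact: measurable_unit_itv.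
    by case/integrableP: ih'.
  under eq_integral do rewrite /= ger0_norm //.
  (* [fine] also sends infinite values to 0, so finiteness is what lets the real integral determine
     the extended one. *)
  have : (\int[mu]_(x in unit_itv) (h x)%:E)%E \is a fin_num.
    by apply: integrable_fin_num ih'; exact: measurable_unit_itv.
  by move=> /fineK <-; rewrite -/(Rintegral mu unit_itv h) ih.
by apply: filterS => x H /H /= [].
Qed.

(** * Test functions with a prescribed derivative, and weakly constant functions *)

Lemma primitive_of_compact_support psi a b : continuous psi ->
  (forall x, x \notin `[a, b] -> psi x = 0) ->
  exists2 Phi : R -> R, forall x, is_derive x 1 Phi (psi x) &
    forall x, x < a -> Phi x = 0.
Proof.
move=> cpsi psi0.
have psiT : mu.-integrable setT (EFin \o psi).
  have : mu.-integrable `[a, b] (EFin \o psi).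
    apply: continuous_compact_integrable; first exact: segment_compact.
    exact: continuous_subspaceT.
  rewrite integrable_mkcond //; apply: eq_integrable => //= x _.
  rewrite patchE; case: ifPn => //; rewrite notin_setE /= => /negP H.
  by rewrite psi0.
(* Integrating from [-oo] makes the primitive vanish to the left of the support. *)
exists (fun x => \int[mu]_(t in `]-oo, x]) psi t) => x.
  have xS : x < x + 1 by rewrite ltrDl.
  have psix : mu.-integrable `]-oo, x + 1] (EFin \o psi).
    exact: integrableS psiT.
  have [d] := continuous_FTC1 xS psix (ltNyr x) (cpsi x).
  by rewrite derive1E => dE; exact: DeriveDef.
move=> xa; rewrite (@eq_Rintegral _ _ _ _ _ (cst 0)) => [|t].
  by rewrite Rintegral_cst ?mul0r.
rewrite inE /= in_itv /= => tx; apply: psi0.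
by rewrite in_itv /= negb_and -!ltNge (le_lt_trans tx).
Qed.

(** The primitive that vanishes left of [a] is constant right of [b]; the zero mean makes that
    constant 0, so the support is compact in the open interval. *)
Lemma test_function_primitive psi a b : 0 < a -> b < 1 -> continuous psi ->
  (forall x, x \notin `[a, b] -> psi x = 0) ->
  \int[mu]_(x in unit_itv) psi x = 0 ->
  exists2 phi, test_function phi & derive1 phi = psi.
Proof.
move=> a0 b1 cpsi psi0 ipsi.
have [phi dphi phi0] := primitive_of_compact_support cpsi psi0.
have phi' : derive1 phi = psi.
  by apply/funext => x; rewrite derive1E; apply: derive_val.
exists phi => //; split.
- by move=> x; have [] := dphi x.
- by rewrite phi'.
exists a, b; split => // x; rewrite in_itv /= negb_and -!ltNge => /orP[/phi0 //|bx].
have phi1 : phi 1 = 0.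
  by have := Rintegral_unit_itv_derive cpsi dphi; rewrite ipsi (phi0 0 a0) subr0.
have cst y z : b < y -> y <= z -> phi z = phi y.
  move=> hb hyz.
  have [|c + /eqP] := MVT_segment hyz (fun x _ => dphi x).
    apply: continuous_subspaceT => t.
    exact/differentiable_continuous/derivable1_diffP.
  rewrite in_itv /= => /andP[yc _]; rewrite psi0 ?mul0r ?subr_eq0 => [/eqP //|].
  by rewrite in_itv /= negb_and -!ltNge (lt_le_trans hb yc) orbT.
by have [/(cst _ _ bx) <-|/ltW /(cst _ _ b1) ->] := leP x 1.
Qed.

(** The du Bois-Reymond lemma: bumps give constancy on each inner interval, and continuity carries
    it to the endpoints. *)
Lemma weakly_constant_unit_itv G : continuous G ->
  (forall phi, test_function phi ->
    \int[mu]_(x in unit_itv) (G x * derive1 phi x) = 0) ->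
  forall x, x \in `[0, 1] -> G x = G 0.
Proof.
move=> cG wG.
have cst a b : 0 < a -> a < b -> b < 1 ->
    exists c, forall x, a < x -> x < b -> G x = c.
  move=> a0 ab b1.
  (* A truncated parabola is smooth enough: its multiples only serve as derivatives of test
     functions, which are just C^1. *)
  pose chi x := Order.max 0 ((x - a) * (b - x)).
  have cchi : continuous chi.
    move=> x.
    apply: (@continuous_max R R (cst 0) (fun x => (x - a) * (b - x)) x).
      exact: cvg_cst.
    by apply: cvgM; apply: cvgB; (exact: cvg_cst || exact: cvg_id).
  have chi0 x : 0 <= chi x by rewrite le_max lexx.
  have chiN x : x \notin `[a, b] -> chi x = 0.
    rewrite in_itv /= negb_and -!ltNge => H; apply/max_idPl.
    case/orP: H => H; first nra.
    by nra.
  have chiP x : a < x -> x < b -> 0 < chi x.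
    by move=> ax xb; rewrite lt_max mulr_gt0 ?orbT // subr_gt0.
  have ichi : \int[mu]_(x in unit_itv) chi x != 0.
    apply/eqP => /(ge0_Rintegral_eq0_continuous cchi chi0) /(_ ((a + b) / 2)).
    have := chiP ((a + b) / 2); rewrite /unit_itv /= in_itv /= => H1 H2.
    suff: 0 < chi ((a + b) / 2) by rewrite H2 ?ltxx //; lra.
    by apply: H1; lra.
  have cchiG : continuous (fun x => chi x * G x).
    by move=> x; apply: cvgM; [exact: cchi|exact: cG].
  pose c := \int[mu]_(x in unit_itv) (chi x * G x) / \int[mu]_(x in unit_itv) chi x.
  pose psi x := chi x * G x - c * chi x.
  have cc : continuous (fun x => c * chi x).
    by move=> x; apply: cvgM; [exact: cvg_cst|exact: cchi].
  have cpsi : continuous psi by move=> x; apply: cvgB; [exact: cchiG|exact: cc].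
  have ipsi : \int[mu]_(x in unit_itv) psi x = 0.
    rewrite Rintegral_unit_itvB // Rintegral_unit_itvZ //.
    by rewrite divfK // subrr.
  have psi0 x : x \notin `[a, b] -> psi x = 0.
    by move=> /chiN; rewrite /psi => ->; rewrite mul0r mulr0 subrr.
  have [phi tphi phi'] := test_function_primitive a0 b1 cpsi psi0 ipsi.
  have := wG _ tphi; rewrite phi' => H.
  (* The integral of [G * psi] is 0 by weak constancy, since [psi] is the derivative of [phi], and
     that of [psi] is 0 by the choice of [c]; yet [q] is a nonnegative square times [chi]. *)
  pose q x := G x * psi x - c * psi x.
  have cGp : continuous (fun x => G x * psi x).
    by move=> x; apply: cvgM; [exact: cG|exact: cpsi].
  have ccp : continuous (fun x => c * psi x).
    by move=> x; apply: cvgM; [exact: cvg_cst|exact: cpsi].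
  have cq : continuous q by move=> x; apply: cvgB; [exact: cGp|exact: ccp].
  have qE x : q x = chi x * (G x - c) ^+ 2 by rewrite /q /psi; ring.
  have iq : \int[mu]_(x in unit_itv) q x = 0.
    rewrite Rintegral_unit_itvB // Rintegral_unit_itvZ //.
    by rewrite H ipsi mulr0 subrr.
  exists c => x ax xb; apply/eqP; rewrite -subr_eq0 -sqrf_eq0.
  have : q x = 0.
    apply: (ge0_Rintegral_eq0_continuous cq) => // [y|].
      by rewrite qE mulr_ge0 // sqr_ge0.
    by rewrite /unit_itv /= in_itv /=; apply/andP; split; lra.
  move/eqP; rewrite qE mulf_eq0 => /orP[|//].
  by rewrite gt_eqF // chiP.
have half : unit_itv (2^-1 : R) by rewrite /unit_itv /= in_itv /=; lra.
have G2 x : x \in `[0, 1] -> G x - G 2^-1 = 0.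
  apply: (@zero_on_closed_unit_itv (fun x => G x - G 2^-1)).
    apply: continuous_subspaceT => y; apply: cvgB; first exact: cG.
    exact: cvg_cst.
  move=> {}x; rewrite /unit_itv /= in_itv /= => /andP[x0 x1].
  (* Both [x] and [2^-1] lie strictly between these bounds, so [G] takes the same value at the two
     points. *)
  pose a := Order.min x 2^-1 / 2; pose b := (1 + Order.max x 2^-1) / 2.
  have [ax a2] : Order.min x 2^-1 <= x /\ Order.min x 2^-1 <= 2^-1.
    by rewrite !ge_min !lexx orbT.
  have a0 : 0 < Order.min x 2^-1 by rewrite lt_min x0 invr_gt0 ltr0n.
  have [bx b2] : x <= Order.max x 2^-1 /\ 2^-1 <= Order.max x 2^-1.
    by rewrite !le_max !lexx orbT.
  have b1 : Order.max x 2^-1 < 1 by rewrite gt_max x1 invf_lt1 // ltr1n.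
  have [||| c Gc] := cst a b; rewrite /a /b; try lra.
  by rewrite !Gc ?subrr // /a /b; lra.
move=> x /G2 /eqP; rewrite subr_eq0 => /eqP ->.
have i0 : 0 \in `[0 : R, 1] by rewrite in_itv /= lexx ler01.
by have /eqP := G2 0 i0; rewrite subr_eq0 => /eqP.
Qed.

(** * Weak solutions of the oscillator equation *)

Lemma test_functionM phi (w w' : R -> R) : test_function phi ->
  (forall x, is_derive x 1 w (w' x)) -> continuous w' ->
  test_function (fun x => phi x * w x) /\
  forall x, derive1 (fun x => phi x * w x) x = derive1 phi x * w x + phi x * w' x.
Proof.
move=> [dphi cphi' [a [b [a0 b1 phi0]]]] dw cw'.
have dphiE x : is_derive x 1 phi (derive1 phi x).
  by rewrite derive1E; apply: DeriveDef.
have cw : continuous w.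
  by move=> x; apply/differentiable_continuous/derivable1_diffP.
have cphi : continuous phi.
  by move=> x; apply/differentiable_continuous/derivable1_diffP.
have dM x : is_derive x 1 (fun x => phi x * w x)
    (derive1 phi x * w x + phi x * w' x).
  apply: (is_derive_eq (is_deriveM (dphiE x) (dw x))).
  by rewrite /GRing.scale /=; ring.
have dME x : derive1 (fun x => phi x * w x) x = derive1 phi x * w x + phi x * w' x.
  by rewrite derive1E; apply: derive_val.
split=> //; split; first by move=> x; have [] := dM x.
  rewrite (_ : derive1 _ = (fun x => derive1 phi x * w x + phi x * w' x));
    last exact/funext.
  move=> x; apply: cvgD; apply: cvgM;
    [exact: cphi'|exact: cw|exact: cphi|exact: cw'].
by exists a, b; split => // x /phi0 ->; rewrite mul0r.
Qed.

Lemma ae_eq_RintegralM f g (p : R -> R) : measurable_fun unit_itv f ->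
  continuous g -> continuous p ->
  {ae mu, forall x, unit_itv x -> f x = g x} ->
  \int[mu]_(x in unit_itv) (f x * p x) = \int[mu]_(x in unit_itv) (g x * p x).
Proof.
move=> mf cg cp fg; congr fine.
have m h : continuous h -> measurable_fun unit_itv h.
  by move=> ch; apply: measurable_funTS; exact: continuous_measurable_fun.
apply: ae_eq_integral.
- exact: measurable_unit_itv.
- by apply/measurable_EFinP; apply: measurable_funM => //; exact: m.
- by apply/measurable_EFinP; apply: measurable_funM; exact: m.
- by apply: (@filterS _ _ (ae_filter_ringOfSetsType mu)) fg => x H /H ->.
Qed.

(* [g w + g1 z] has derivative [g1 (w + z') + g (w' - k^2 z)] along solutions of
   [g' = g1], [g1' = - k^2 g]. *)
Lemma weak_oscillator_invariant (k : R) g g1 (w z : R -> R) : continuous g -> continuous g1 ->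
  (forall phi, test_function phi -> \int[mu]_(x in unit_itv) (g x * derive1 phi x) =
     - \int[mu]_(x in unit_itv) (g1 x * phi x)) ->
  (forall phi, test_function phi -> \int[mu]_(x in unit_itv) (g1 x * derive1 phi x) =
     k ^+ 2 * \int[mu]_(x in unit_itv) (g x * phi x)) ->
  (forall x, is_derive x 1 w (k ^+ 2 * z x)) ->
  (forall x, is_derive x 1 z (- w x)) ->
  forall x, x \in `[0, 1] -> g x * w x + g1 x * z x = g 0 * w 0 + g1 0 * z 0.
Proof.
move=> cg cg1 wg wg1 dw dz.
have cw : continuous w.
  by move=> x; apply/differentiable_continuous/derivable1_diffP.
have cz : continuous z.
  by move=> x; apply/differentiable_continuous/derivable1_diffP.
have cM (p q : R -> R) : continuous p -> continuous q -> continuous (fun x => p x * q x).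
  by move=> cp cq x; apply: cvgM; [exact: cp|exact: cq].
have ck (p : R -> R) : continuous p -> continuous (fun x => k ^+ 2 * p x).
  by move=> cp x; apply: cvgM; [exact: cvg_cst|exact: cp].
have cN (p : R -> R) : continuous p -> continuous (fun x => - p x).
  by move=> cp x; apply: cvgN; exact: cp.
apply: (@weakly_constant_unit_itv (fun x => g x * w x + g1 x * z x)).
  by move=> x; apply: cvgD; apply: cvgM; [exact: cg|exact: cw|exact: cg1|exact: cz].
move=> phi tphi.
have [tw twE] := test_functionM tphi dw (ck _ cz).
have [tz tzE] := test_functionM tphi dz (cN _ cw).
have cphi : continuous phi.
  by move=> x; apply/differentiable_continuous/derivable1_diffP; case: tphi.
have ctw : continuous (derive1 (fun x => phi x * w x)) by case: tw.
have ctz : continuous (derive1 (fun x => phi x * z x)) by case: tz.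
(* [A] tests the first equation with [phi * w], and [B] the second with [phi * z]. In the sum only
   [(g w + g1 z)] times the derivative of [phi] survives. *)
pose A x := g x * derive1 (fun x => phi x * w x) x + g1 x * (phi x * w x).
pose B x := g1 x * derive1 (fun x => phi x * z x) x - k ^+ 2 * (g x * (phi x * z x)).
have cpw := cM _ _ cphi cw; have cpz := cM _ _ cphi cz.
have cgw := cM _ _ cg ctw; have cgw1 := cM _ _ cg1 cpw.
have cgz1 := cM _ _ cg1 ctz; have cgz := cM _ _ cg cpz; have ckgz := ck _ cgz.
have iA : \int[mu]_(x in unit_itv) A x = 0.
  by rewrite Rintegral_unit_itvD // wg // addNr.
have iB : \int[mu]_(x in unit_itv) B x = 0.
  by rewrite Rintegral_unit_itvB // Rintegral_unit_itvZ // wg1 // subrr.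
have cA : continuous A by move=> x; apply: cvgD; [exact: cgw|exact: cgw1].
have cB : continuous B by move=> x; apply: cvgB; [exact: cgz1|exact: ckgz].
rewrite -[RHS](addr0 0) -{1}iA -iB -Rintegral_unit_itvD //.
by apply: eq_Rintegral => x _; rewrite /A /B twE tzE; ring.
Qed.

(** The invariant is used with the weights [(cos (k x), - sin (k x) / k)] and
    [(k sin (k x), cos (k x))]. At 0 they are [(1, 0)] and [(0, 1)], so they read off the Cauchy
    data at 0. *)
Lemma weak_oscillator_unit_itv (k : R) f f1 g g1 : k != 0 ->
  measurable_fun unit_itv f -> measurable_fun unit_itv f1 ->
  {within `[0, 1], continuous g} -> {within `[0, 1], continuous g1} ->
  {ae mu, forall x, unit_itv x -> f x = g x} ->
  {ae mu, forall x, unit_itv x -> f1 x = g1 x} ->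
  (forall phi, test_function phi -> \int[mu]_(x in unit_itv) (f x * derive1 phi x) =
     - \int[mu]_(x in unit_itv) (f1 x * phi x)) ->
  (forall phi, test_function phi -> \int[mu]_(x in unit_itv) (f1 x * derive1 phi x) =
     - \int[mu]_(x in unit_itv) (- (k ^+ 2 * f x) * phi x)) ->
  forall x, x \in `[0, 1] ->
    g x * cos (k * x) - g1 x * (sin (k * x) / k) = g 0 /\
    g x * (k * sin (k * x)) + g1 x * cos (k * x) = g1 0.
Proof.
move=> k0 mf mf1 /continuous_extension_unit_itv[h ch hE].
move=> /continuous_extension_unit_itv[h1 ch1 h1E] fg f1g1 wf wf1.
have sub x : unit_itv x -> x \in `[0, 1] by exact: subset_itv_oo_cc.
have fh : {ae mu, forall x, unit_itv x -> f x = h x}.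
  by apply: (@filterS _ _ (ae_filter_ringOfSetsType mu)) fg => x H ux; rewrite hE ?sub // H.
have f1h1 : {ae mu, forall x, unit_itv x -> f1 x = h1 x}.
  by apply: (@filterS _ _ (ae_filter_ringOfSetsType mu)) f1g1 => x H ux; rewrite h1E ?sub // H.
have tc phi : test_function phi -> continuous phi.
  by move=> [dphi _ _] x; apply/differentiable_continuous/derivable1_diffP.
have tc' phi : test_function phi -> continuous (derive1 phi) by case.
have wh phi : test_function phi -> \int[mu]_(x in unit_itv) (h x * derive1 phi x) =
     - \int[mu]_(x in unit_itv) (h1 x * phi x).
  move=> tphi; rewrite -(ae_eq_RintegralM mf ch (tc' _ tphi) fh) wf //.
  by rewrite (ae_eq_RintegralM mf1 ch1 (tc _ tphi) f1h1).
have wh1 phi : test_function phi -> \int[mu]_(x in unit_itv) (h1 x * derive1 phi x) =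
     k ^+ 2 * \int[mu]_(x in unit_itv) (h x * phi x).
  move=> tphi; rewrite -(ae_eq_RintegralM mf1 ch1 (tc' _ tphi) f1h1) wf1 //.
  have ckphi : continuous (fun x => - k ^+ 2 * phi x).
    by move=> x; apply: cvgM; [exact: cvg_cst|exact: tc].
  rewrite (_ : \int[mu]_(x in unit_itv) _ =
      \int[mu]_(x in unit_itv) (f x * (- k ^+ 2 * phi x))); last first.
    by apply: eq_Rintegral => x _; ring.
  rewrite (ae_eq_RintegralM mf ch ckphi fh).
  rewrite (_ : \int[mu]_(x in unit_itv) _ =
      \int[mu]_(x in unit_itv) (- k ^+ 2 * (h x * phi x))); last first.
    by apply: eq_Rintegral => x _; ring.
  rewrite Rintegral_unit_itvZ; first by ring.
  by move=> x; apply: cvgM; [exact: ch|exact: tc].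
have dk x : is_derive x 1 (fun x => k * x) k.
  by apply: is_derive_eq; rewrite /GRing.scale /= mulr1.
have dcos x : is_derive x 1 (fun x => cos (k * x)) (- (k * sin (k * x))).
  apply: (is_derive_eq (is_derive1_comp (is_derive_cos (k * x)) (dk x))).
  by ring.
have dsin x : is_derive x 1 (fun x => sin (k * x)) (k * cos (k * x)).
  apply: (is_derive_eq (is_derive1_comp (is_derive_sin (k * x)) (dk x))).
  by ring.
have i0 : 0 \in `[0 : R, 1] by rewrite in_itv /= lexx ler01.
move=> x ix; rewrite -!hE // -!h1E //; split.
- have dw (y : R) : is_derive y 1 (fun x => cos (k * x)) (k ^+ 2 * (- k^-1 * sin (k * y))).
    by apply: (is_derive_eq (dcos y)); field.
  have dz (y : R) : is_derive y 1 (fun x => - k^-1 * sin (k * x)) (- cos (k * y)).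
    by apply: is_derive_eq; rewrite /GRing.scale /=; field.
  have := weak_oscillator_invariant ch ch1 wh wh1 dw dz ix.
  by rewrite mulr0 cos0 sin0 !mulr0 addr0 mulr1 => <-; ring.
- have := @weak_oscillator_invariant k h h1 (fun x => k * sin (k * x))
    (fun x => cos (k * x)) ch ch1 wh wh1.
  move=> /(_ _ _ x ix); rewrite mulr0 cos0 sin0 !mulr0 add0r mulr1; apply.
  by move=> y; apply: is_derive_eq; rewrite /GRing.scale /=; ring.
Qed.

End UnitInterval.

(** * Real estimates: distance to the multiples of pi and the dispersion bound *)

Lemma norm_sin_cosD_pi_nat (R : realType) (x : R) (n : nat) :
  `|sin (x + n%:R * pi)| = `|sin x| /\ `|cos (x + n%:R * pi)| = `|cos x|.
Proof.
rewrite mulr_natl (alternatingn (@sinDpi R)) (alternatingn (@cosDpi R)).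
by rewrite !normrM !normrX normrN1 expr1n !mul1r.
Qed.

Lemma norm_sin_cosB_pi_int (R : realType) (x : R) (n : int) :
  `|sin (x - n%:~R * pi)| = `|sin x| /\ `|cos (x - n%:~R * pi)| = `|cos x|.
Proof.
case: n => n.
  have [<- <-] := norm_sin_cosD_pi_nat (x - n%:R * pi) n.
  by rewrite subrK.
by rewrite (NegzE n) mulrNz mulNr opprK -pmulrn; exact: norm_sin_cosD_pi_nat.
Qed.

(** This is [x <= tan x] freed of division: [sin y - y cos y] vanishes at 0 and has derivative
    [y sin y >= 0]. *)
Lemma mul_cos_le_sin (R : realType) (x : R) : 0 <= x -> x <= pi -> x * cos x <= sin x.
Proof.
move=> x0 xpi.
pose F (y : R) : R := sin y - y * cos y.
have dF (y : R) : is_derive y 1 F (y * sin y).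
  by apply: is_derive_eq; rewrite /GRing.scale /=; ring.
have [|c] := MVT_segment x0 (fun y _ => dF y).
  apply: continuous_subspaceT => y.
  exact/differentiable_continuous/derivable1_diffP.
rewrite in_itv /= => /andP[c0 cx].
rewrite /F sin0 mul0r !subr0 => H; rewrite -subr_ge0 H mulr_ge0 // mulr_ge0 //.
by apply: sin_ge0_pi; rewrite c0 (le_trans cx xpi).
Qed.

Lemma dist_multiple_pi_le (R : realType) (k t : R) :
  `|sin k| <= t * `|cos k| -> exists n : int, `|k - n%:~R * pi| <= t.
Proof.
move=> skt.
have pi0 := pi_gt0 R.
(* Rounding [k / pi] to a nearest integer leaves a remainder [d] with [|d| <= pi / 2], where the
   cosine is nonnegative. *)
pose n := Num.floor (k / pi + 2^-1).
have /andP[n1 n2] : n%:~R <= k / pi + 2^-1 < n%:~R + 1.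
  by rewrite floor_le_tmp /= -intrD1 floorD1_gt.
exists n; set d := k - n%:~R * pi.
have [sE cE] := norm_sin_cosB_pi_int k n.
rewrite -/d in sE cE.
have kE : k = k / pi * pi by rewrite divfK // gt_eqF.
have d2 : `|d| <= pi / 2.
  by rewrite ler_norml /d {1 2}kE; apply/andP; split; nra.
have dpi : `|d| <= pi by lra.
have ndpi : 0 <= `|d| by [].
have s0 : 0 <= sin `|d| by apply: sin_ge0_pi; rewrite ndpi dpi.
have c0 : 0 <= cos `|d| by apply: cos_ge0_pihalf; lra.
have sd : sin `|d| = `|sin k|.
  rewrite -(ger0_norm s0) -sE; case: (ger0P d) => // _.
  by rewrite sinN normrN.
have cd : cos `|d| = `|cos k| by rewrite -cE -(ger0_norm c0) cos_norm.
have := mul_cos_le_sin ndpi dpi; rewrite sd => /le_trans /(_ skt); rewrite -cd.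
have [c1|] := ltP 0 (cos `|d|); first by rewrite ler_pM2r.
(* If the cosine vanished, the hypothesis would make the sine vanish too. *)
move=> c1; have c2 : cos `|d| = 0 by apply/eqP; rewrite eq_le c1.
move: skt; rewrite -cd c2 mulr0 -sd => s1.
have := cos2Dsin2 `|d|.
have -> : sin `|d| = 0 by apply/eqP; rewrite eq_le s0 s1.
by rewrite c2 expr0n /= addr0 => /eqP; rewrite eq_sym oner_eq0.
Qed.

(* With [A = \sum x y], squaring [x (sigma t) = c x t + s / k * y t] and summing gives
   [s^2 \sum x^2 = 2 c s / k * A + s^2 / k^2 * \sum y^2], and [|2 A|] is at most
   [2 sqrt 3 \sum x^2] by AM-GM. *)
Lemma flip_dispersion_bound (R : realType) (T : finType) (sigma : T -> T)
    (x y : T -> R) (c s k : R) : involutive sigma ->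
  0 < k -> c ^+ 2 + s ^+ 2 = 1 ->
  (forall t, x (sigma t) = c * x t + s / k * y t) ->
  0 < \sum_t x t ^+ 2 -> \sum_t y t ^+ 2 <= 3 * \sum_t x t ^+ 2 ->
  `|s| * (1 - 3 / k ^+ 2) <= 2 * Num.sqrt 3 / k * `|c|.
Proof.
move=> sigmaK k0 cs xs X0 YX.
set X := \sum_t x t ^+ 2 in X0 YX *; set Y := \sum_t y t ^+ 2 in YX *.
pose A := \sum_t x t * y t.
pose w : R := Num.sqrt 3.
have w0 : 0 < w by rewrite sqrtr_gt0 ltr0n.
have w2 : w ^+ 2 = 3 by rewrite sqr_sqrtr // ler0n.
have XE : X = c ^+ 2 * X + 2 * c * (s / k) * A + (s / k) ^+ 2 * Y.
  rewrite {1}/X (reindex_inj (inv_inj sigmaK)) /= /X /A /Y !mulr_sumr -!big_split /=.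
  by apply: eq_bigr => t _; rewrite xs; ring.
have AM (e : R) : e ^+ 2 = 1 -> e * A <= w * X.
  move=> e2; have : 0 <= \sum_t (w * x t - e * y t) ^+ 2.
    by apply: sumr_ge0 => t _; rewrite sqr_ge0.
  have -> : \sum_t (w * x t - e * y t) ^+ 2 = 3 * X - 2 * e * w * A + Y.
    rewrite /X /A /Y !mulr_sumr -sumrB -big_split /=.
    apply: eq_bigr => t _.
    have -> : (w * x t - e * y t) ^+ 2 =
      w ^+ 2 * x t ^+ 2 - 2 * e * w * (x t * y t) + e ^+ 2 * y t ^+ 2 by ring.
    by rewrite w2 e2 mul1r.
  have wwX : w * (w * X) = 3 * X by rewrite mulrA -expr2 w2.
  by move=> H; rewrite -(ler_pM2l w0) wwX; lra.
have nA : `|A| <= w * X.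
  have e1 : (-1 : R) ^+ 2 = 1 by rewrite sqrrN expr1n.
  by have := AM 1 (expr1n _ _); have := AM (-1) e1; rewrite ler_norml; lra.
(* The final inequality is obtained by cancelling [|s|], hence the separate case. *)
have [->|s0] := eqVneq s 0;
  first by rewrite normr0 mul0r mulr_ge0 // divr_ge0 ?mulr_ge0 // ltW.
have ns0 : 0 < `|s| by rewrite normr_gt0.
have ik0 : 0 < k^-1 by rewrite invr_gt0.
have s2 : `|s| ^+ 2 = s ^+ 2 by rewrite real_normK // num_real.
have eq1 : s ^+ 2 * X = 2 * k^-1 * (c * s * A) + s ^+ 2 * k^-1 ^+ 2 * Y.
  have : X = c ^+ 2 * X + s ^+ 2 * X by rewrite -mulrDl cs mul1r.
  by move: XE; lra.
have b1 : c * s * A <= `|c| * `|s| * (w * X).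
  by rewrite (le_trans (ler_norm _)) // !normrM ler_pM.
have b2 : s ^+ 2 * k^-1 ^+ 2 * Y <= s ^+ 2 * k^-1 ^+ 2 * (3 * X).
  by rewrite ler_wpM2l // mulr_ge0 // sqr_ge0.
rewrite -exprVn.
rewrite -(ler_pM2r ns0) -(ler_pM2r X0).
have b3 : 2 * k^-1 * (c * s * A) <= 2 * k^-1 * (`|c| * `|s| * (w * X)).
  by rewrite ler_wpM2l // mulr_ge0 // ltW.
have -> : `|s| * (1 - 3 * k^-1 ^+ 2) * `|s| * X =
    s ^+ 2 * X - s ^+ 2 * k^-1 ^+ 2 * (3 * X) by rewrite -s2; ring.
rewrite -/w; lra.
Qed.

(** Dividing by [1 - 3 / k ^+ 2] changes the right-hand side only by O(1/k^3), which the generous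
    term [100 / k ^+ 2] absorbs. *)
Lemma dispersion_bound_lt (R : realType) (k t : R) : 10 <= k ->
  t * (1 - 3 / k ^+ 2) <= 2 * Num.sqrt 3 / k ->
  t < 2 * Num.sqrt 3 / k + 100 / k ^+ 2.
Proof.
move=> k10; set w : R := Num.sqrt 3.
have w0 : 0 <= w by rewrite sqrtr_ge0.
have w2 : w < 2.
  have : w ^+ 2 = 3 by rewrite sqr_sqrtr // ler0n.
  by rewrite ltNge => ?; apply/negP => ?; nra.
have k0 : 0 < k by lra.
rewrite -exprVn; set i := k^-1.
have i0 : 0 < i by rewrite invr_gt0.
have i10 : i <= 10^-1 by rewrite lef_pV2 // posrE.
move=> H; rewrite ltNge; apply/negP => H2.
have i2 : 0 < i ^+ 2 by rewrite exprn_gt0.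
(* This is the excess of [(2 w i + 100 i^2) (1 - 3 i^2)] over [2 w i]; it is positive since [w < 2]
   and [i <= 1/10]. *)
have : 0 < i ^+ 2 * (100 - 6 * w * i - 300 * i ^+ 2).
  by rewrite mulr_gt0 //; nra.
have : (2 * w * i + 100 * i ^+ 2) * (1 - 3 * i ^+ 2) <= t * (1 - 3 * i ^+ 2).
  by rewrite ler_wpM2r //; nra.
by lra.
Qed.

(** * The vertex coupling in degree 3 *)

Lemma sum_edge_ends (A : nmodType) (V E : finType) (d : nat)
    (vert : E * bool -> V) (num : V -> 'I_d -> E * bool) (F : E * bool -> A) :
  numbering vert num -> \sum_t F t = \sum_v \sum_m F (num v m).
Proof.
move=> hnum; rewrite (partition_big vert xpredT) //=; apply: eq_bigr => v _.
have [inj numP] := hnum v.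
rewrite -(@big_imset _ _ _ _ _ (num v) 'I_d F) /=; last by move=> m l _ _; exact: inj.
apply: eq_bigl => t; apply/eqP/imsetP => [/numP [m <-]|[m _ ->]]; first by exists m.
by apply/numP; exists m.
Qed.

Lemma coupling_cyclic (R : realType) (d : nat) (psi psi' : 'cV[R[i]]_d) (m : 'I_d) :
  coupling psi psi' ->
  psi (ordS m) 0 - psi m 0 + 'i%C * (psi' (ordS m) 0 + psi' m 0) = 0.
Proof.
have cE (p : 'cV[R[i]]_d) : (cyclic_mx *m p) m 0 = p (ordS m) 0.
  rewrite mxE (bigD1 (ordS m)) //= mxE eqxx mul1r big1 ?addr0 // => l /negPf lm.
  by rewrite mxE lm mul0r.
move=> /matrixP /(_ m 0); rewrite mulmxBl mulmxDl !mul1mx complexiE.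
by rewrite !mxE -cE -cE !mxE.
Qed.

Lemma sum_ord3 (A : nmodType) (F : 'I_3 -> A) :
  \sum_m F m = F ord0 + F (ordS ord0) + F (ordS (ordS ord0)).
Proof.
rewrite !big_ord_recl big_ord0 addr0 addrA.
by congr (F _ + F _ + F _); exact: val_inj.
Qed.

Lemma ordS3 (m : 'I_3) : ordS (ordS (ordS m)) = m.
Proof. by apply: val_inj; case: m => -[|[|[|]]]. Qed.

(** Indexing the two parts by a boolean turns a complex vector into a real family, whose squared
    norm is a plain sum of squares. *)
Definition complex_part (R : realType) (z : R[i]) (b : bool) : R :=
  if b then complex.Im z else complex.Re z.

(** The alternating sum of the three cyclic equations isolates [psi' m], as the degree is odd. The
    factor [i] exchanges the two parts, whence [~~ b] and the sign; [ordS (ordS m)] is the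
    predecessor of [m]. *)
Lemma coupling3 (R : realType) (psi psi' : 'cV[R[i]]_3) (m : 'I_3) (b : bool) :
  coupling psi psi' ->
  complex_part (psi' m 0) b = (-1) ^+ (~~ b) *
    (complex_part (psi (ordS m) 0) (~~ b) -
     complex_part (psi (ordS (ordS m)) 0) (~~ b)).
Proof.
move=> cpl; have := coupling_cyclic m cpl.
have := coupling_cyclic (ordS m) cpl; have := coupling_cyclic (ordS (ordS m)) cpl.
rewrite ordS3.
case: (psi m 0) (psi (ordS m) 0) (psi (ordS (ordS m)) 0) => [p0 q0] [p1 q1] [p2 q2].
case: (psi' m 0) (psi' (ordS m) 0) (psi' (ordS (ordS m)) 0) => [r0 s0] [r1 s1] [r2 s2].
by move=> /= [] ? ? [] ? ? [] ? ?; case: b => /=; rewrite ?expr1 ?expr0; lra.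
Qed.

(* With [S] the sum of the [psi m], the squares of the differences add up to
   [3 \sum_m psi m ^+ 2 - S ^+ 2]. *)
Lemma coupling3_sum_sqr_le (R : realType) (psi psi' : 'cV[R[i]]_3) :
  coupling psi psi' ->
  \sum_m \sum_b complex_part (psi' m 0) b ^+ 2 <=
  3 * \sum_m \sum_b complex_part (psi m 0) b ^+ 2.
Proof.
move=> cpl; rewrite !sum_ord3 !big_bool !(coupling3 _ _ cpl) !ordS3 /=.
set p0 := complex.Re (psi ord0 0); set q0 := complex.Im (psi ord0 0).
set p1 := complex.Re (psi (ordS ord0) 0); set q1 := complex.Im (psi (ordS ord0) 0).
set p2 := complex.Re (psi (ordS (ordS ord0)) 0).
set q2 := complex.Im (psi (ordS (ordS ord0)) 0).
rewrite expr0 expr1.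
have := sqr_ge0 (p0 + p1 + p2); have := sqr_ge0 (q0 + q1 + q2).
lra.
Qed.

(** * Boundary data of an eigenfunction on one edge *)

Lemma L2_measurable_fun (R : realType) (f : R -> R[i]) (b : bool) : L2 f ->
  measurable_fun unit_itv (fun x => complex_part (f x) b).
Proof.
have aux (h : R -> R) :
    patch (fun=> 0) unit_itv h \in Lfun lebesgue_measure 2%:E ->
    measurable_fun unit_itv h.
  move=> /sub_Lfun_mfun; rewrite inE /= => mh.
  apply: (eq_measurable_fun (patch (fun=> 0) unit_itv h)).
    by move=> x xu; rewrite patchE xu.
  exact: measurable_funTS.
by case=> hr hi; case: b; exact: aux.
Qed.

(** The two boundary values come with possibly different representatives; these agree almost
    everywhere, hence by continuity everywhere on [[0, 1]], in particular at 1. *)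
Lemma boundary_value_representative (R : realType) (f : R -> R[i]) (z0 z1 : R[i]) :
  boundary_value f false z0 -> boundary_value f true z1 ->
  exists g : R -> R[i],
    [/\ forall b, {within `[0, 1], continuous (fun x => complex_part (g x) b)},
        {ae lebesgue_measure, forall x, unit_itv x -> f x = g x},
        g 0 = z0 & g 1 = z1].
Proof.
move=> [g [cr ci fg g0]] [h [hr hi fh h1]]; exists g.
have cg b : {within `[0, 1], continuous (fun x => complex_part (g x) b)} by case: b.
have ch b : {within `[0, 1], continuous (fun x => complex_part (h x) b)} by case: b.
have gh b : complex_part (g 1) b = complex_part (h 1) b.
  pose d x := complex_part (g x) b - complex_part (h x) b.
  have cd : {within `[0, 1], continuous d}.
    by move=> x; apply: cvgB; [exact: cg|exact: ch].
  have [e ce eE] := continuous_extension_unit_itv cd.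
  have sub x : unit_itv x -> x \in `[0 : R, 1] by exact: subset_itv_oo_cc.
  have e0 : {ae lebesgue_measure, forall x, unit_itv x -> e x = 0}.
    move: fg fh; apply: (@filterS2 _ _ (ae_filter_ringOfSetsType _)) => x H1 H2 ux.
    by rewrite eE ?sub // /d -H1 // -H2 // subrr.
  have := @zero_on_closed_unit_itv _ d cd => /(_ _ 1) H.
  apply/eqP; rewrite -subr_eq0; apply/eqP; apply: H.
    by move=> x ux; rewrite -eE ?sub //; exact: ae_zero_continuous e0 _ ux.
  by rewrite in_itv /= ler01 lexx.
split => //; rewrite -h1 /=.
by have := gh false; have := gh true; case: (g 1) (h 1) => [? ?] [? ?] /= -> ->.
Qed.

(** Here [w0] and [w1] are derivatives in the direction of the edge, so [w1] is minus the outgoing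
    derivative. The last clause is uniqueness for vanishing Cauchy data at 0. *)
Lemma edge_relation (R : realType) (k : R) (f f1 : R -> R[i]) (z0 z1 w0 w1 : R[i]) :
  k != 0 -> W22 f f1 (fun x => - ((k ^+ 2)%:C * f x)) ->
  boundary_value f false z0 -> boundary_value f true z1 ->
  boundary_value f1 false w0 -> boundary_value f1 true w1 ->
  (forall b,
    complex_part z1 b * cos k - complex_part w1 b * (sin k / k) = complex_part z0 b /\
    complex_part z1 b * (k * sin k) + complex_part w1 b * cos k = complex_part w0 b) /\
  (z0 = 0 -> w0 = 0 ->
    {ae lebesgue_measure, forall x, unit_itv x -> f x = 0}).
Proof.
move=> k0 [[L2f L2f1 wf] [_ _ wf1]] bf0 bf1 bg0 bg1.
have [g [cg fg <- <-]] := boundary_value_representative bf0 bf1.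
have [g1 [cg1 fg1 <- <-]] := boundary_value_representative bg0 bg1.
have sol b x : x \in `[0, 1] ->
    complex_part (g x) b * cos (k * x) - complex_part (g1 x) b * (sin (k * x) / k) =
      complex_part (g 0) b /\
    complex_part (g x) b * (k * sin (k * x)) + complex_part (g1 x) b * cos (k * x) =
      complex_part (g1 0) b.
  apply: (@weak_oscillator_unit_itv R k (fun x => complex_part (f x) b)
    (fun x => complex_part (f1 x) b) (fun x => complex_part (g x) b)
    (fun x => complex_part (g1 x) b)) => //.
  - exact: L2_measurable_fun.
  - exact: L2_measurable_fun.
  - by apply: (@filterS _ _ (ae_filter_ringOfSetsType _)) fg => y H /H ->.
  - by apply: (@filterS _ _ (ae_filter_ringOfSetsType _)) fg1 => y H /H ->.
  - by move=> phi /wf [? ?]; case: b.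
  - move=> phi /wf1 [hr hi]; case: b; rewrite /complex_part ?hr ?hi; congr (- _);
      by apply: eq_Rintegral => y _; case: (f y) => p q /=; ring.
split=> [b|g00 g10].
  by have := sol b 1; rewrite mulr1; apply; rewrite in_itv /= ler01 lexx.
apply: (@filterS _ _ (ae_filter_ringOfSetsType _)) fg => x H ux; rewrite H //.
have gx0 b : complex_part (g x) b = 0.
  have [] := sol b x; first exact: subset_itv_oo_cc.
  have -> : complex_part (g 0) b = 0 by rewrite g00; case: b.
  have -> : complex_part (g1 0) b = 0 by rewrite g10; case: b.
  set p := complex_part (g x) b; set r := complex_part (g1 x) b => e1 e2.
  (* Cramer's rule for [p]: the linear system [e1], [e2] has determinant 1. *)
  have : p * (cos (k * x) ^+ 2 + sin (k * x) ^+ 2) =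
      (p * cos (k * x) - r * (sin (k * x) / k)) * cos (k * x) +
      (p * (k * sin (k * x)) + r * cos (k * x)) * (sin (k * x) / k) by field.
  by rewrite cos2Dsin2 e1 e2 !mul0r addr0 mulr1.
by have := gx0 false; have := gx0 true; case: (g x) => [? ?] /= -> ->.
Qed.

(** * Norm comparison on the tetrahedral graph *)

Theorem theorem3p2 (R : realType) (P : 'I_4 -> 'rV[R]_3)
    (vert : tetra_edge * bool -> 'I_4)
    (num : 'I_4 -> 'I_3 -> tetra_edge * bool)
    (hP : regular_tetrahedron P) (hvert : edge_ends vert)
    (hnum : numbering vert num) (hcw : clockwise P vert num) :
  exists C K : R, [/\ 0 < C, 0 < K &
    forall k : R, K <= k -> hamiltonian_eigenvalue num (k ^+ 2)%:C ->
      exists n : int,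
        `|k - n%:~R * pi| < 2 * Num.sqrt 3 / k + C / k ^+ 2].
Proof.
exists 100, 10; split; [lra|lra|].
move=> k k10 [f [[f1 [val [der [hW hv hd hc]]]] nz]].
have k0 : 0 < k by lra.
have kn0 : k != 0 by rewrite gt_eqF.
have hd0 e : boundary_value (f1 e) false (der (e, false)).
  by have := hd e false; rewrite expr0 mul1r.
have hd1 e : boundary_value (f1 e) true (- der (e, true)).
  by have := hd e true; rewrite expr1 mulN1r.
have rel e := edge_relation kn0 (hW e) (hv e false) (hv e true) (hd0 e) (hd1 e).
pose x (t : tetra_edge * bool * bool) := complex_part (val t.1) t.2.
pose y (t : tetra_edge * bool * bool) := complex_part (der t.1) t.2.
(* This is the swap [J]: it exchanges the ends of an edge and keeps the real or imaginary part. *)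
pose sigma (t : tetra_edge * bool * bool) := (t.1.1, ~~ t.1.2, t.2).
have sigmaK : involutive sigma by move=> [[e b] c]; rewrite /sigma /= negbK.
have cs := cos2Dsin2 k.
have xs t : x (sigma t) = cos k * x t + sin k / k * y t.
  case: t => [[e b] c]; have [] := (rel e).1 c; rewrite /x /y /sigma /=.
  have -> : complex_part (- der (e, true)) c = - complex_part (der (e, true)) c.
    by case: (der _) => p q; case: c.
  case: b => /=; first by move=> <- _; ring.
  (* At the end 0 the edge relations express the data at 0 through those at 1; they are inverted by
     [cos^2 + sin^2 = 1]. *)
  move=> <- <-; rewrite -[LHS]mulr1 -cs; by field.
have YX : \sum_t y t ^+ 2 <= 3 * \sum_t x t ^+ 2.
  rewrite -(pair_bigA _ (fun t b => complex_part (der t) b ^+ 2)).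
  rewrite -(pair_bigA _ (fun t b => complex_part (val t) b ^+ 2)) /=.
  rewrite !(sum_edge_ends _ hnum) mulr_sumr; apply: ler_sum => v _.
  have E (u : tetra_edge * bool -> R[i]) :
      \sum_m \sum_b complex_part ((\col_l u (num v l)) m 0) b ^+ 2 =
      \sum_m \sum_b complex_part (u (num v m)) b ^+ 2.
    by apply: eq_bigr => m _; apply: eq_bigr => b _; rewrite mxE.
  by have := coupling3_sum_sqr_le (hc v); rewrite !E.
have X0 : 0 < \sum_t x t ^+ 2.
  rewrite lt_neqAle sumr_ge0 ?andbT => [|t _]; last exact: sqr_ge0.
  (* If all boundary values vanish, [YX] kills the derivatives as well, and uniqueness makes the
     eigenfunction zero on every edge. *)
  apply/eqP => /esym X0; apply: nz => e.
  have Y0 : \sum_t y t ^+ 2 = 0.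
    apply/eqP; rewrite eq_le sumr_ge0 ?andbT => [|t _]; last exact: sqr_ge0.
    by rewrite (le_trans YX) // X0 mulr0.
  have x0 t : x t = 0.
    apply/eqP; rewrite -sqrf_eq0; apply/eqP.
    by apply: (psumr_eq0P _ X0) => // u _; exact: sqr_ge0.
  have y0 t : y t = 0.
    apply/eqP; rewrite -sqrf_eq0; apply/eqP.
    by apply: (psumr_eq0P _ Y0) => // u _; exact: sqr_ge0.
  apply: (rel e).2.
    have := x0 (e, false, true); have := x0 (e, false, false); rewrite /x /=.
    by case: (val _) => ? ? /= -> ->.
  have := y0 (e, false, true); have := y0 (e, false, false); rewrite /y /=.
  by case: (der _) => ? ? /= -> ->.
have := flip_dispersion_bound sigmaK k0 cs xs X0 YX.
have d0 : 0 < 1 - 3 / k ^+ 2.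
  by rewrite subr_gt0 ltr_pdivrMr ?exprn_gt0 // mul1r; nra.
(* Dividing by [1 - 3 / k ^+ 2] brings the bound to the form [|sin k| <= t * |cos k|]. *)
rewrite -ler_pdivlMr // mulrAC.
move=> /dist_multiple_pi_le[n kn]; exists n; apply: le_lt_trans kn _.
by apply: dispersion_bound_lt => //; rewrite divfK // gt_eqF.
Qed.
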